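(* There exists a separable Banach space whose dual norm is AMUC$^*$ but which admits no equivalent norm whose dual norm is AUC$^*$.
   Context: For a Banach space $X$, let $\mathrm{cof}_{w^*}(X^* )$ be the set of weak$^*$-closed subspaces of $X^*$ of finite codimension; $S_Y$ denotes the unit sphere of $Y$; $\inf\emptyset=+\infty$. A norm on $X^*$ is AUC$^*$ if for all $t>0$, $\inf_{x^*\in S_{X^*}}\sup_{Y\in\mathrm{cof}_{w^*}(X^* )}\inf_{y^*\in S_Y}(\|x^*+ty^*\|-1)>0$. It is AMUC$^*$ if for all $t>0$, $\inf_{x^*\in S_{X^*}}\sup_{Y\in\mathrm{cof}_{w^*}(X^* )}\inf_{y^*\in S_Y}(\max\{\|x^*+ty^*\|,\|x^*-ty^*\|\}-1)>0$. *)

(* Defs.v *)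
From HB Require Import structures.
From mathcomp Require Import all_boot all_order all_algebra.
From mathcomp Require Import all_classical all_reals all_analysis.

Set Implicit Arguments.
Unset Strict Implicit.
Unset Printing Implicit Defensive.

Import Order.TTheory GRing.Theory Num.Theory.
Import numFieldNormedType.Exports.

Local Open Scope classical_set_scope.
Local Open Scope ring_scope.

Definition separable (T : topologicalType) :=
  exists2 A : set T, countable A & dense A.

Section Dual.
Variables (R : realType) (X : normedModType R).

Definition continuous_linear : {pred X -> R^o} :=
  mem [set f : X -> R^o | linear f /\ continuous f].

Lemma continuous_linear_submod_closed : submod_closed continuous_linear.
Proof.
split=> [|a f g /set_mem[lf cf] /set_mem[lg cg]]; apply/mem_set; split.
- by move=> a x y; rewrite /= scaler0 addr0.
- by move=> x; exact: cst_continuous.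
- move=> b x y; rewrite !fctE lf lg !scalerDr !scalerA (mulrC b a).
  by rewrite addrACA.
- move=> x; apply: (@continuousD _ R^o); last exact: cg.
  by apply: continuousZl_tmp; exact: cf.
Qed.

HB.instance Definition _ := GRing.isSubmodClosed.Build R (X -> R^o)
  continuous_linear continuous_linear_submod_closed.

(* The topological dual X^*, with its pointwise vector space structure. It only
   depends on the topology of X, so it is the same for all equivalent norms. *)
Record dual := Dual {
  dual_val :> X -> R^o ;
  dual_valP : dual_val \in continuous_linear }.

HB.instance Definition _ := [isSub for dual_val].
HB.instance Definition _ := [Choice of dual by <:].
HB.instance Definition _ := [SubChoice_isSubZmodule of dual by <:].
HB.instance Definition _ := [SubZmodule_isSubLmodule of dual by <:].

(* The dual with its weak^* topology, i.e. that of pointwise convergence. *)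
Definition weak_star :=
  initial_topology (dual_val : dual -> {ptws X -> R^o}).

HB.instance Definition _ := Topological.copy weak_star
  (initial_topology (dual_val : dual -> {ptws X -> R^o})).

(* V / Y is spanned by the classes of finitely many vectors. *)
Definition finite_codim (V : lmodType R) (Y : set V) :=
  exists (n : nat) (e : 'I_n -> V),
    forall v, exists c : 'I_n -> R, Y (v - \sum_(i < n) c i *: e i).

Definition cof_weak_star : set (set dual) :=
  [set Y | [/\ submod_closed (mem Y), closed (Y : set weak_star)
             & finite_codim Y]].

Definition is_norm (p : X -> R) :=
  [/\ forall x y, p (x + y) <= p x + p y,
      forall a x, p (a *: x) = `|a| * p x
    & forall x, p x = 0 -> x = 0].

Definition equivalent_norm (p : X -> R) :=
  is_norm p /\ exists c C : R,
    [/\ 0 < c, 0 < C & forall x, c * `|x| <= p x <= C * `|x|].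

Definition dual_norm (p : X -> R) (f : dual) : R :=
  sup [set `|f x| | x in [set x | p x <= 1]].

Section AsymptoticConvexity.
Variable N : dual -> R.

Definition unit_sphere (Y : set dual) : set dual := [set f | Y f /\ N f = 1].

(* Infima and suprema are taken in \bar R, where inf set0 = +oo. *)
Definition AUC_star :=
  forall t : R, 0 < t ->
    (0 < ereal_inf
      [set ereal_sup
        [set ereal_inf
          [set (N (f + t *: g) - 1)%:E | g in unit_sphere Y]
        | Y in cof_weak_star]
      | f in unit_sphere setT])%E.

Definition AMUC_star :=
  forall t : R, 0 < t ->
    (0 < ereal_inf
      [set ereal_sup
        [set ereal_inf
          [set (Num.max (N (f + t *: g)) (N (f - t *: g)) - 1)%:E
          | g in unit_sphere Y]
        | Y in cof_weak_star]
      | f in unit_sphere setT])%E.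

End AsymptoticConvexity.
End Dual.

(* Main.v *)
From HB Require Import structures.
Require Import Defs.
From mathcomp Require Import all_boot all_order all_algebra.
From mathcomp Require Import all_classical all_reals all_analysis.
From mathcomp Require Import lra.

(** The space is [C(K)] for a countable compact space [K] of infinite
    Cantor-Bendixson rank, here a tree of finite sequences whose branches
    through [n] have length at most [n.+1] (so [K] is a copy of the ordinal
    interval [0, omega^omega]). It is described without any topology on [K]:
    the finite-range retractions [retr N] of the tree form an approximate
    identity, and a function is continuous when its composites with them
    converge to it uniformly.

    The dual is an [l_1]-space. What is used of this fact is that every
    functional is, up to a small error, carried by finitely many points
    ([dual_carried]). Hence the norm is already AMUC-star
    ([tree_space_AMUC]): given [f] almost carried by the finite range [F] of
    some [retr N], let [Y] be the annihilator of the finite-dimensional space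
    of functions [u \o retr N]. If [g] is in [Y] then its norm is almost
    attained, up to a factor 2, on functions [z] vanishing on [F], and since
    [f] does not see such perturbations, lattice operations produce [y] in
    the unit ball almost norming [f] with [`|g y|] at least [1 / 4]
    ([midpoint_fun]). Then [f y + t * `|g y|] is a lower bound for the larger
    of the norms of [f + t *: g] and [f - t *: g].

    No equivalent norm has an AUC-star dual norm [N] ([not_AUC]). The Dirac
    functionals at the children of a node converge weak-star to the one at the
    node while staying far from it, and a weak-star null sequence comes
    arbitrarily near each weak-star closed subspace of finite codimension
    ([weak_star_null_near_cof]). So if [N] were AUC-star, some child would have
    a Dirac functional of norm larger by a fixed factor than that of its
    parent ([dirac_growth]). Branches of arbitrary finite length then make
    the norms unbounded, although they are bounded by equivalence of the
    norms. *)

Set Implicit Arguments.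
Unset Strict Implicit.
Unset Printing Implicit Defensive.

Import Order.TTheory GRing.Theory Num.Theory.
Import numFieldNormedType.Exports.

Local Open Scope classical_set_scope.
Local Open Scope ring_scope.

(** * The tree and its finite retractions *)

(** The longest prefix of [s] of length at most [h] with entries below [N]. *)
Fixpoint climb (N h : nat) (s : seq nat) : seq nat :=
  match h, s with
  | h'.+1, k :: s' => if (k < N)%N then k :: climb N h' s' else [::]
  | _, _ => [::]
  end.

Lemma size_climb N h s : (size (climb N h s) <= h)%N.
Proof. by elim: h s => [|h IH] [|k s] //=; case: ifP => // _; exact: IH. Qed.

Lemma climb_climb N M h s : climb N h (climb M h s) = climb (minn N M) h s.
Proof.
elim: h s => [|h IH] [|k s] //=.
by rewrite leq_min andbC; case: ifP => //= _; rewrite IH.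
Qed.

(** The climbs for [N <= M] are nested prefixes, so a strict change adds at
    least one to the length. This is what bounds how often [climb N h s] can
    change when [N] grows. *)
Lemma climb_mono N M h s : (N <= M)%N ->
  (size (climb N h s) + (climb N h s != climb M h s) <= size (climb M h s))%N.
Proof.
move=> NM; elim: h s => [|h IH] [|k s] //=.
case: ifPn => [kN|_]; last by case: ifP.
by rewrite (leq_trans kN NM)/= eqseq_cons eqxx/= addSn ltnS; exact: IH.
Qed.

Lemma climb_id M h s : all (ltn^~ M) s -> (size s <= h)%N -> climb M h s = s.
Proof.
elim: h s => [|h IH] [|k s] //= /andP[kM sM] sh.
by rewrite [(k < M)%N]kM IH.
Qed.

Lemma climb_rcons M h s k : all (ltn^~ M) s -> (size s <= h)%N -> (M <= k)%N ->
  climb M h (rcons s k) = s.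
Proof.
move=> + + Mk; elim: h s => [|h IH] [|j s] //=; first by rewrite ltnNge Mk.
by move=> /andP[jM sM] sh; rewrite [(j < M)%N]jM IH.
Qed.

(** Cutting the sequences starting with [n] at length [n.+1] makes the tree
    well founded, which gives the [l_1]-dual, but leaves branches of every finite
    length, which excludes AUC-star. *)
Definition retr (N : nat) (s : seq nat) := climb N (head 0%N s).+1 s.

Lemma retr_far N s : (N <= head 0%N s)%N -> retr N s = [::].
Proof. by rewrite /retr; case: s => [|n s]//= Nn; rewrite ltnNge Nn. Qed.

Lemma head_retr N s : (head 0%N s < N)%N ->
  head 0%N (retr N s) = head 0%N s.
Proof. by rewrite /retr; case: s => [|n s]//= ->. Qed.

Lemma retr_retr N M s : retr N (retr M s) = retr (minn N M) s.
Proof.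
case: (ltnP (head 0%N s) M) => nM.
  by rewrite /retr -climb_climb -/(retr M s) head_retr.
by rewrite (retr_far nM) [RHS]retr_far // (leq_trans _ nM) // geq_minr.
Qed.

Lemma retr_idem N s : retr N (retr N s) = retr N s.
Proof. by rewrite retr_retr minnn. Qed.

Lemma retr_retrC N M s : retr N (retr M s) = retr M (retr N s).
Proof. by rewrite !retr_retr minnC. Qed.

Lemma size_retr N s : (size (retr N s) <= (head 0%N s).+1)%N.
Proof. exact: size_climb. Qed.

Lemma retr_mono N M s : (N <= M)%N ->
  (size (retr N s) + (retr N s != retr M s) <= size (retr M s))%N.
Proof. exact: climb_mono. Qed.

(** The root [[::]] is left out: the branches that matter start at some
    [[:: n]]. *)
Definition node s := (0 < size s <= (head 0%N s).+1)%N.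

Lemma retr_node M s : all (ltn^~ M) s -> node s -> retr M s = s.
Proof. by move=> sM /andP[_ sh]; exact: climb_id. Qed.

(** Far children are retracted onto their parent: the children of a node
    converge to it. *)
Lemma retr_child M s k : all (ltn^~ M) s -> node s -> (M <= k)%N ->
  retr M (rcons s k) = s.
Proof.
case: s => [|n s]// sM /andP[_ sh] Mk.
exact: (@climb_rcons M n.+1 (n :: s)).
Qed.

(** The retraction [retr N] has its values in the finite list [words N N]. *)
Fixpoint words (N h : nat) : seq (seq nat) :=
  if h is h'.+1 then [::] :: [seq k :: s | k <- iota 0 N, s <- words N h']
  else [:: [::]].

Lemma climb_words N h s : climb N h s \in words N h.
Proof.
elim: h s => [|h IH] [|k s] //=.
case: ifP => // kN; rewrite in_cons/=; apply: allpairs_f => //.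
by rewrite mem_iota.
Qed.

Lemma words_le N h h' : (h <= h')%N -> {subset words N h <= words N h'}.
Proof.
elim: h h' => [|h IH] [|h'] //= hh' s; first by [].
  by rewrite mem_seq1 => /eqP ->; rewrite in_cons eqxx.
rewrite !in_cons => /orP[->//|/allpairsP[[k u]/= [kN uh ->]]].
by apply/orP; right; apply: allpairs_f => //; exact: IH.
Qed.

Definition retr_words N := undup (words N N).

Lemma mem_retr_words N s : retr N s \in retr_words N.
Proof.
rewrite mem_undup; case: (ltnP (head 0%N s) N) => nN.
  exact/(words_le nN)/climb_words.
by rewrite retr_far//; case: (N).
Qed.

(** * The Banach space *)

Section Space.
Variable R : realType.
Implicit Types (e : R) (s t : seq nat).

(** Uniform continuity for the profinite uniformity defined by the retractions.
    A sequence too long to be a node has the same retractions as its longest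
    prefix that is one, so these are the continuous functions on the compact tree
    made of the root and the nodes. *)
Definition tree_continuous : {pred seq nat -> R^o} :=
  mem [set x : seq nat -> R^o |
       forall e, 0 < e -> exists N, forall s, `|x (retr N s) - x s| <= e].

Lemma tree_continuousP (x : seq nat -> R^o) : x \in tree_continuous <->
  forall e, 0 < e -> exists N, forall s, `|x (retr N s) - x s| <= e.
Proof. by split=> [/set_mem//|?]; exact/mem_set. Qed.

Lemma tree_continuous_near (x : seq nat -> R^o) : x \in tree_continuous ->
  forall e, 0 < e -> exists N, forall M, (N <= M)%N ->
    forall s, `|x (retr M s) - x s| <= e.
Proof.
move=> /tree_continuousP xP e e0.
have [N xN] := xP (e / 2) ltac:(lra).
exists N => M NM s.
have := xN (retr M s); rewrite retr_retr (minn_idPl NM) => h1.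
have h2 := xN s.
by move: h1 h2; rewrite !ler_norml => /andP[? ?] /andP[? ?]; apply/andP; split; lra.
Qed.

(** A Lipschitz function of two variables preserves continuity: this covers both
    the linear and the lattice operations. *)
Lemma tree_continuous2 (F : R -> R -> R) (c : R) (x y : seq nat -> R^o) :
  (forall a a' b b', `|F a b - F a' b'| <= c * (`|a - a'| + `|b - b'|)) ->
  x \in tree_continuous -> y \in tree_continuous ->
  (fun s => F (x s) (y s)) \in tree_continuous.
Proof.
move=> FL xP yP; apply/tree_continuousP => e e0.
have d0 : 0 < e / (2 * (`|c| + 1)).
  by rewrite divr_gt0// mulr_gt0// ltr_wpDl.
have [N1 h1] := tree_continuous_near xP d0.
have [N2 h2] := tree_continuous_near yP d0.
exists (maxn N1 N2) => s; apply: le_trans (FL _ _ _ _) _.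
have {}h1 := h1 _ (leq_maxl N1 N2) s; have {}h2 := h2 _ (leq_maxr N1 N2) s.
rewrite (@le_trans _ _ (`|c| * (e / (2 * (`|c| + 1)) + e / (2 * (`|c| + 1)))))//.
  apply: (@le_trans _ _ (`|c| * (`|x (retr (maxn N1 N2) s) - x s| + `|y (retr (maxn N1 N2) s) - y s|))).
    by apply: ler_wpM2r; rewrite ?addr_ge0// ler_norm.
  by apply: ler_wpM2l => //; exact: lerD.
have -> : e / (2 * (`|c| + 1)) + e / (2 * (`|c| + 1)) = e / (`|c| + 1).
  by rewrite invfM mulrA -mulrDl -splitr.
rewrite mulrA ler_pdivrMr ?ltr_wpDl// mulrC ler_pM2l//.
by rewrite lerDl.
Qed.

Lemma tree_continuous_submod_closed : submod_closed tree_continuous.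
Proof.
split=> [|a x y xP yP].
  by apply/tree_continuousP => e e0; exists 0%N => s; rewrite subrr normr0 ltW.
apply: (tree_continuous2 (F := fun u v => a * u + v) (c := `|a| + 1)) => //.
move=> u u' v v'; rewrite opprD addrACA -mulrBr.
rewrite (le_trans (ler_normD _ _))// normrM mulrDr lerD//.
  by rewrite ler_wpM2r// lerDl.
by rewrite ler_peMl// lerDr.
Qed.

HB.instance Definition _ := GRing.isSubmodClosed.Build R (seq nat -> R^o)
  tree_continuous tree_continuous_submod_closed.

Record tree_space := TreeFun {
  tree_val :> seq nat -> R^o ;
  tree_valP : tree_val \in tree_continuous }.

HB.instance Definition _ := [isSub for tree_val].
HB.instance Definition _ := [Choice of tree_space by <:].
HB.instance Definition _ := [SubChoice_isSubZmodule of tree_space by <:].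
HB.instance Definition _ := [SubZmodule_isSubLmodule of tree_space by <:].

Implicit Types x y z w : tree_space.

Lemma treeP x y : (forall s, x s = y s) -> x = y.
Proof. by move=> xy; apply/val_inj/funext. Qed.

Lemma tree_valD x y s : (x + y) s = x s + y s. Proof. by []. Qed.
Lemma tree_valN x s : (- x) s = - x s. Proof. by []. Qed.
Lemma tree_valB x y s : (x - y) s = x s - y s. Proof. by []. Qed.
Lemma tree_valZ a x s : (a *: x) s = a * x s. Proof. by []. Qed.

Definition tree_norm x := sup (range (fun s => `|x s|)).

(** Within distance 1, a continuous function takes finitely many values. *)
Lemma tree_has_ubound x : has_ubound (range (fun s => `|x s|)).
Proof.
have [N xN] := (tree_continuousP x).1 (tree_valP x) 1 ltr01.
exists (1 + \sum_(a <- retr_words N) `|x a|) => _ [s _ <-].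
have -> : x s = (x s - x (retr N s)) + x (retr N s) by rewrite subrK.
rewrite (le_trans (ler_normD _ _))// lerD//; first by rewrite distrC.
rewrite (big_rem _ (mem_retr_words N s))/= lerDl.
by apply: sumr_ge0.
Qed.

Lemma tree_norm_ge x s : `|x s| <= tree_norm x.
Proof. by apply: ub_le_sup; [exact: tree_has_ubound|exists s]. Qed.

Lemma tree_norm_le x a : (forall s, `|x s| <= a) -> tree_norm x <= a.
Proof.
by move=> xa; apply: ge_sup; [exists `|x [::]|, [::]|move=> _ [s _ <-]].
Qed.

Lemma tree_normD x y : tree_norm (x + y) <= tree_norm x + tree_norm y.
Proof.
apply: tree_norm_le => s; rewrite tree_valD.
by rewrite (le_trans (ler_normD _ _))// lerD// tree_norm_ge.
Qed.

Lemma tree_normZ a x : tree_norm (a *: x) = `|a| * tree_norm x.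
Proof.
have le b y : tree_norm (b *: y) <= `|b| * tree_norm y.
  apply: tree_norm_le => s; rewrite tree_valZ normrM.
  by rewrite ler_wpM2l// tree_norm_ge.
apply/le_anti; rewrite le//=.
have [->|a0] := eqVneq a 0.
  by rewrite normr0 mul0r (le_trans _ (tree_norm_ge _ [::])).
have := le a^-1 (a *: x); rewrite scalerA mulVf// scale1r normfV.
by rewrite ler_pdivlMl// normr_gt0.
Qed.

Lemma tree_norm_eq0 x : tree_norm x = 0 -> x = 0.
Proof.
move=> x0; apply: treeP => s; apply/normr0_eq0/le_anti.
by rewrite normr_ge0 -x0 tree_norm_ge.
Qed.

HB.instance Definition _ := Lmodule_isNormed.Build R tree_space
  tree_normD tree_normZ tree_norm_eq0.

Lemma norm_ge x s : `|x s| <= `|x|. Proof. exact: tree_norm_ge. Qed.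
Lemma norm_le x a : (forall s, `|x s| <= a) -> `|x| <= a.
Proof. exact: tree_norm_le. Qed.

Lemma tree_space_complete (F : set_system tree_space) :
  ProperFilter F -> cauchy F -> cvg F.
Proof.
move=> FF /cauchy_ballP Fc.
have {}Fc e : 0 < e -> \forall x & y \near F,
    forall s, `|(x : tree_space) s - (y : tree_space) s| <= e.
  move=> e0; have := Fc e e0.
  apply: filterS => -[x y] /=; rewrite -ball_normE/= => xy s.
  by rewrite -tree_valB; apply: le_trans (norm_ge _ _) (ltW xy).
have Fs s : cvg ((fun x : tree_space => x s) @ F).
  apply/cauchy_cvgP/cauchy_ballP => e e0.
  have [AB FAB sAB] := Fc (e / 2) ltac:(lra); rewrite near_map2.
  exists AB => // -[x y] /sAB/= /(_ s) h; rewrite -ball_normE/=.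
  by apply: le_lt_trans h _; lra.
pose l s := lim ((fun x : tree_space => x s) @ F) : R.
have near_l e : 0 < e -> \forall x \near F,
    forall s, `|(x : tree_space) s - l s| <= e.
  move=> e0; near=> x => s.
  apply: (@closed_cvg _ _ F _ (fun y : tree_space => x s - y s)
    [set a : R | `|a| <= e] _ _ (x s - l s)) => //.
  - apply: (@preimage_closed R R (fun a : R => `|a|) [set a | a <= e]).
      by move=> a _; exact: norm_continuous.
    exact: closed_le.
  - near=> y; rewrite /=; move: s; near: y; near: x; apply: nearP_dep; exact: Fc.
  - by apply: cvgB; [exact: cvg_cst|exact: Fs].
have lP : l \in tree_continuous.
  apply/tree_continuousP => e e0.
  near F => x.
  have xl : forall s, `|x s - l s| <= e / 3.
    by near: x; apply: near_l; lra.
  have [N xN] := (tree_continuousP x).1 (tree_valP x) (e / 3) ltac:(lra).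
  exists N => s; have := xl s; have := xl (retr N s); have := xN s.
  rewrite !ler_norml => /andP[? ?] /andP[? ?] /andP[? ?]; apply/andP; split; lra.
apply/cvg_ex; exists (TreeFun lP); apply/cvgrPdist_le => e e0.
near=> x; apply: norm_le => s; rewrite tree_valB distrC /=.
by move: s; near: x; exact: near_l.
Unshelve. all: by end_near. Qed.

HB.instance Definition _ :=
  Uniform_isComplete.Build tree_space tree_space_complete.

End Space.

(** * Dual norms *)

Section DualNorm.
Variables (R : realType) (X : normedModType R).
Implicit Types (f g : dual X) (x y : X) (p : X -> R).

Lemma dual_linear f : linear f.
Proof. by have /set_mem[] := dual_valP f. Qed.

Lemma dual_continuous f : continuous f.
Proof. by have /set_mem[] := dual_valP f. Qed.

Lemma dual_valD f g x : (f + g) x = f x + g x. Proof. by []. Qed.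
Lemma dual_valB f g x : (f - g) x = f x - g x. Proof. by []. Qed.
Lemma dual_valZ a f x : (a *: f) x = a * f x. Proof. by []. Qed.

Lemma dualD f x y : f (x + y) = f x + f y.
Proof. by have := dual_linear f 1 x y; rewrite !scale1r. Qed.
Lemma dual0 f : f 0 = 0.
Proof. by apply: (addrI (f 0)); rewrite -dualD !addr0. Qed.
Lemma dualZ f a x : f (a *: x) = a * f x.
Proof. by have := dual_linear f a x 0; rewrite !addr0 dual0 addr0. Qed.
Lemma dualN f x : f (- x) = - f x.
Proof. by rewrite -scaleN1r dualZ mulN1r. Qed.
Lemma dualB f x y : f (x - y) = f x - f y.
Proof. by rewrite dualD dualN. Qed.

Lemma dual_val_sum I (r : seq I) (F : I -> dual X) x :
  (\sum_(i <- r) F i) x = \sum_(i <- r) F i x.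
Proof. by elim/big_rec2: _ => // i a b _ <-; rewrite dual_valD. Qed.

Lemma dual_sum I (r : seq I) (F : I -> X) f :
  f (\sum_(i <- r) F i) = \sum_(i <- r) f (F i).
Proof. by elim/big_rec2: _ => [|i a b _ <-]; rewrite ?dual0// dualD. Qed.

Lemma dual_bound f : exists2 M, 0 < M & forall x, `|f x| <= M * `|x|.
Proof.
pose L : {linear X -> R^o} :=
  HB.pack (f : X -> R^o) (GRing.isLinear.Build R X R^o _ f (@dual_linear f)).
have /linear_boundedP/pinfty_ex_gt0[M M0 fM] : bounded_near L (nbhs 0).
  by apply/linear_bounded_continuous; exact: (@dual_continuous f).
by exists M.
Qed.

(** The way to build elements of the dual. *)
Lemma bounded_continuous_linear (u : X -> R^o) (M : R) :
  linear u -> (forall x, `|u x| <= M * `|x|) -> u \in @continuous_linear R X.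
Proof.
move=> lu uM; apply/mem_set; split => //.
pose L : {linear X -> R^o} :=
  HB.pack u (GRing.isLinear.Build R X R^o _ u lu).
apply: (@bounded_linear_continuous _ _ _ L).
apply/linear_boundedP; near=> r => x; apply: le_trans (uM x) _.
by rewrite ler_wpM2r.
Unshelve. all: by end_near. Qed.

Lemma equivalent_norm_id : equivalent_norm (fun x : X => `|x|).
Proof.
split; first by split => [x y|a x|x /normr0_eq0//]; rewrite ?ler_normD ?normrZ.
by exists 1, 1; split=> // x; rewrite mul1r lexx.
Qed.

Variable p : X -> R.
Hypothesis p_equiv : equivalent_norm p.
Local Notation N := (dual_norm p).

Let pZ a x : p (a *: x) = `|a| * p x. Proof. by case: p_equiv => -[]. Qed.
Let p0 : p 0 = 0.
Proof. by rewrite -(scale0r (0 : X)) pZ normr0 mul0r. Qed.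

Lemma equivalent_norm_ge0 x : 0 <= p x.
Proof.
case: p_equiv => _ [c [C [c0 _ /(_ x)/andP[h _]]]].
by apply: le_trans h; rewrite mulr_ge0// ltW.
Qed.

Lemma equivalent_norm_gt0 x : x != 0 -> 0 < p x.
Proof.
move=> x0; rewrite lt_neqAle equivalent_norm_ge0 andbT eq_sym.
by apply: contra_neq x0; case: p_equiv => -[_ _ h] _; exact: h.
Qed.

Let has_ubound_N f : has_ubound [set `|f x| | x in [set x | p x <= 1]].
Proof.
have [M M0 fM] := dual_bound f.
case: p_equiv => _ [c [C [c0 _ pc]]].
exists (M / c) => _ [x /= px <-]; apply: le_trans (fM x) _.
apply: ler_wpM2l; first exact: ltW.
rewrite -(ler_pM2l c0) mulfV ?gt_eqF//.
by apply: le_trans px; case/andP: (pc x).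
Qed.

Lemma dual_norm_ball f x : p x <= 1 -> `|f x| <= N f.
Proof. by move=> px; apply: ub_le_sup => //; exists x. Qed.

Lemma dual_norm_ge0 f : 0 <= N f.
Proof. by apply: le_trans (@dual_norm_ball f 0 _) => //; rewrite p0. Qed.

Lemma dual_norm_ge f x : `|f x| <= N f * p x.
Proof.
have [->|x0] := eqVneq x 0; first by rewrite dual0 normr0 p0 mulr0.
have px := equivalent_norm_gt0 x0.
have := @dual_norm_ball f ((p x)^-1 *: x).
rewrite pZ gtr0_norm ?invr_gt0// mulVf ?gt_eqF// => /(_ (lexx _)).
by rewrite dualZ normrM gtr0_norm ?invr_gt0// ler_pdivrMl// mulrC.
Qed.

Lemma dual_norm_le f a : (forall x, p x <= 1 -> `|f x| <= a) -> N f <= a.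
Proof.
move=> fa; apply: ge_sup; first by exists `|f 0|, 0 => //=; rewrite p0.
by move=> _ [x px <-]; exact: fa.
Qed.

Lemma dual_normD f g : N (f + g) <= N f + N g.
Proof.
apply: dual_norm_le => x px; rewrite dual_valD (le_trans (ler_normD _ _))//.
by rewrite lerD// dual_norm_ball.
Qed.

Lemma dual_normZ a f : N (a *: f) = `|a| * N f.
Proof.
have le b g : N (b *: g) <= `|b| * N g.
  apply: dual_norm_le => x px; rewrite dual_valZ normrM.
  by rewrite ler_wpM2l// dual_norm_ball.
apply/le_anti; rewrite le//=.
have [->|a0] := eqVneq a 0; first by rewrite normr0 mul0r dual_norm_ge0.
have := le a^-1 (a *: f); rewrite scalerA mulVf// scale1r normfV.
by rewrite ler_pdivlMl// normr_gt0.
Qed.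

Lemma dual_normN f : N (- f) = N f.
Proof. by rewrite -scaleN1r dual_normZ normrN1 mul1r. Qed.

Lemma dual_normB f g : N (f - g) <= N f + N g.
Proof. by rewrite -(dual_normN g) dual_normD. Qed.

Lemma dual_norm_sum I (r : seq I) (F : I -> dual X) :
  N (\sum_(i <- r) F i) <= \sum_(i <- r) N (F i).
Proof.
elim/big_rec2: _ => [|i a b _ h]; last by rewrite (le_trans (dual_normD _ _))// lerD2l.
by apply: dual_norm_le => x _; rewrite normr0.
Qed.

Lemma dual_norm_approx f a : a < N f -> exists2 x, p x <= 1 & a < f x.
Proof.
move=> aN; have hs : has_sup [set `|f x| | x in [set x | p x <= 1]].
  by split=> //; exists `|f 0|, 0 => //=; rewrite p0.
have e0 : 0 < N f - a by rewrite subr_gt0.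
have [_ [x px <-]] := sup_adherent e0 hs.
rewrite subKr; have [fx|fx] := leP 0 (f x) => afx.
  by exists x => //; rewrite -(ger0_norm fx).
exists (- x); last by rewrite dualN -(ltr0_norm fx).
by rewrite -scaleN1r pZ normrN1 mul1r.
Qed.

End DualNorm.

(** * Constructing elements of the space *)

Section Construct.
Variable R : realType.
Local Notation X := (tree_space R).
Implicit Types (x y z w : X) (s t : seq nat).

Lemma pullback_subproof x (r : seq nat -> seq nat) :
  (forall N s, retr N (r s) = r (retr N s)) ->
  (fun s => x (r s)) \in @tree_continuous R.
Proof.
move=> rC; apply/tree_continuousP => e e0.
have [N xN] := (tree_continuousP x).1 (tree_valP x) e e0.
by exists N => s; rewrite -rC.
Qed.

Definition pullback x r rC : X := TreeFun (@pullback_subproof x r rC).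

Lemma step_fun_subproof N (u : seq nat -> R^o) :
  (fun s => u (retr N s)) \in @tree_continuous R.
Proof.
by apply/tree_continuousP => e e0; exists N => s; rewrite retr_idem subrr normr0 ltW.
Qed.

Definition step_fun N u : X := TreeFun (step_fun_subproof N u).

Definition cst_fun (a : R) : X := step_fun 0 (fun=> a).

Lemma max_lip (a a' b b' : R) :
  `|Num.max a b - Num.max a' b'| <= 1 * (`|a - a'| + `|b - b'|).
Proof.
have := ler_norm (a - a'); have := ler_norm (a' - a); rewrite (distrC a' a).
have := ler_norm (b - b'); have := ler_norm (b' - b); rewrite (distrC b' b).
case: (leP a b); case: (leP a' b') => *; rewrite ler_norml; apply/andP; split; lra.
Qed.

Lemma min_lip (a a' b b' : R) :
  `|Num.min a b - Num.min a' b'| <= 1 * (`|a - a'| + `|b - b'|).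
Proof.
have := ler_norm (a - a'); have := ler_norm (a' - a); rewrite (distrC a' a).
have := ler_norm (b - b'); have := ler_norm (b' - b); rewrite (distrC b' b).
case: (leP a b); case: (leP a' b') => *; rewrite ler_norml; apply/andP; split; lra.
Qed.

Definition max_fun x y : X :=
  TreeFun (tree_continuous2 max_lip (tree_valP x) (tree_valP y)).
Definition min_fun x y : X :=
  TreeFun (tree_continuous2 min_lip (tree_valP x) (tree_valP y)).

Lemma max_funE x y s : max_fun x y s = Num.max (x s) (y s).
Proof. by []. Qed.
Lemma min_funE x y s : min_fun x y s = Num.min (x s) (y s).
Proof. by []. Qed.
Lemma cst_funE a s : cst_fun a s = a. Proof. by []. Qed.

Let latE := (max_funE, min_funE, tree_valD, tree_valB, tree_valN, cst_funE).

(** [y] is [x] clipped at each point to the interval where both [y] and [y + z]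
    stay in the unit ball. The interval is nonempty because [`|z| <= 2], and it
    is the whole of [[-1, 1]] where [z] vanishes, so that nothing is changed
    there. *)
Lemma midpoint_fun x z : `|x| <= 1 -> `|z| <= 2 ->
  exists y, [/\ `|y| <= 1, `|y + z| <= 1 & forall s, z s = 0 -> y s = x s].
Proof.
move=> x1 z2; pose c1 := cst_fun 1.
exists (min_fun (max_fun x (max_fun (- c1) (- c1 - z))) (min_fun c1 (c1 - z))).
have xs s : - 1 <= x s <= 1.
  by rewrite -ler_norml; apply: le_trans (norm_ge _ _) x1.
have zs s : - 2 <= z s <= 2.
  by rewrite -ler_norml; apply: le_trans (norm_ge _ _) z2.
split=> [||s zs0].
- apply: norm_le => s; have /andP[? ?] := xs s; have /andP[? ?] := zs s.
  rewrite !latE ler_norml !le_min !le_max !ge_min.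
  apply/andP; split; last by apply/orP; right; apply/orP; left; lra.
  by apply/andP; split; [apply/orP; right; apply/orP; left|apply/andP; split]; lra.
- apply: norm_le => s; have /andP[? ?] := xs s; have /andP[? ?] := zs s.
  rewrite tree_valD ler_norml -lerBlDr -[(_ + z s <= _)%R]lerBrDr.
  rewrite !latE !le_min !le_max !ge_min.
  apply/andP; split; last by apply/orP; right; apply/orP; right; lra.
  by apply/andP; split; [apply/orP; right; apply/orP; right|apply/andP; split]; lra.
- have /andP[? ?] := xs s; rewrite !latE zs0 !subr0 maxxx minxx.
  by rewrite (max_idPl _)// (min_idPl _).
Qed.

(** Rational step functions are dense. *)
Lemma tree_separable : separable X.
Proof.
pose u (Nr : nat * seq rat) : X :=
  step_fun Nr.1 (fun s => ratr (nth 0 Nr.2 (index s (retr_words Nr.1)))).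
exists (range u); first by apply: sub_countable (card_image_le u _) _.
move=> O [x Ox] oO.
have /nbhs_ballP[e /= e0 xeO] : nbhs x O by apply: open_nbhs_nbhs.
have d0 : 0 < e / 4 by lra.
have [N xN] := (tree_continuousP x).1 (tree_valP x) _ d0.
have /choice[g gP] (a : R) : exists q, `|ratr q - a| <= e / 4.
  have : a - e / 4 < a + e / 4 by lra.
  move=> /rat_in_itvoo[q]; rewrite in_itv/= => /andP[q1 q2].
  by exists q; rewrite ler_norml; apply/andP; split; lra.
exists (u (N, [seq g (x s) | s <- retr_words N])); split; last by exists (N, [seq g (x s) | s <- retr_words N]).
apply: xeO; rewrite -ball_normE/=.
apply: (@le_lt_trans _ _ (e / 4 + e / 4)); last lra.
apply: norm_le => s; rewrite tree_valB/=.
rewrite (nth_map [::]) ?index_mem ?mem_retr_words// nth_index ?mem_retr_words//.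
have := xN s; have := gP (x (retr N s)).
by rewrite !ler_norml => /andP[? ?] /andP[? ?]; apply/andP; split; lra.
Qed.

End Construct.

(** * Functionals are carried by finite sets of nodes *)

Section Shrinking.
Variable R : realType.
Local Notation X := (tree_space R).
Implicit Types (x y z w : X) (s t : seq nat) (f : dual X).

(** If [f] were not almost carried by the range of any [r N], there would be
    functions [v] of norm at most 1, factoring through a later retraction
    [r M], vanishing on the range of [r N] and with [f v] bounded below. Such a
    [v] vanishes at the points [s] with [r N s = r M s], so that the number of
    terms of a sum of successive [v]'s that are nonzero at [s] is bounded by the
    height of [s]. The sums would be bounded by [h], while their images under
    [f] grow linearly. *)
Lemma carried_of_height (r : nat -> seq nat -> seq nat) (ht : seq nat -> nat)
    (h : nat) f :
  (forall N M s, retr N (r M s) = r M (retr N s)) ->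
  (forall M s, r M s = s \/ r M s = retr M s) ->
  (forall N M s, (N <= M)%N ->
    (ht (r N s) + (r N s != r M s) <= ht (r M s))%N) ->
  (forall M s, (ht (r M s) <= h)%N) ->
  forall e, 0 < e ->
  exists N, forall w, (forall s, w (r N s) = 0) -> `|f w| <= e * `|w|.
Proof.
move=> rC r_or ht_mono ht_le e e0; apply: contrapT => notN.
have {notN}block N : exists w, [/\ forall s, w (r N s) = 0, `|w| <= 1 & e < f w].
  apply: contrapT => notw; apply: notN; exists N => w wN.
  rewrite leNgt; apply/negP => wf; apply: notw.
  have w0 : 0 < `|w|.
    rewrite normr_gt0; apply: contraTneq wf => ->.
    by rewrite dual0 !normr0 mulr0 ltxx.
  exists (Num.sg (f w) / `|w| *: w); split.
  - by move=> s; rewrite tree_valZ wN mulr0.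
  - rewrite normrZ normrM normfV normr_id divfK ?gt_eqF//.
    by rewrite normr_sg; case: (_ != _).
  - by rewrite dualZ mulrAC -normrEsg ltr_pdivlMr.
have [B B0 fB] := dual_bound f.
have d0 : 0 < e / 2 / B by rewrite !divr_gt0.
(* The sum of [m] blocks is dominated by the height reached after [r N]. *)
have stack m : exists N w, (forall s, `|w s| <= (ht (r N s))%:R) /\
    m%:R * (e / 2) <= f w.
  elim: m => [|m [N [w [wN fw]]]].
    by exists 0%N, 0; split=> [s|]; rewrite ?normr0// mul0r dual0.
  have [v [vN v1 fv]] := block N.
  have [M0 vM] := tree_continuous_near (tree_valP v) d0.
  pose M := maxn N M0; pose vM' := pullback v (fun K => rC K M).
  have vv' : `|v - vM'| <= e / 2 / B.
    apply: norm_le => s; rewrite tree_valB/= distrC.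
    case: (r_or M s) => ->; first by rewrite subrr normr0 ltW.
    by apply: vM; exact: leq_maxr.
  exists M, (w + vM'); split=> [s|].
    have hM := ht_mono N M s (leq_maxl _ _).
    rewrite -(ler_nat R) natrD in hM; apply: le_trans _ hM; rewrite tree_valD (le_trans (ler_normD _ _))// lerD//=.
    case: eqP => [<-|_]; first by rewrite vN normr0.
    by apply: le_trans (norm_ge _ _) v1.
  have : `|f (v - vM')| <= e / 2.
    apply: le_trans (fB _) _; rewrite mulrC -ler_pdivlMr//.
  rewrite dualB dualD ler_norml => /andP[? ?].
  by rewrite -natr1 mulrDl mul1r; lra.
have [N [w [wN]]] := stack (Num.bound (B * h%:R / (e / 2))).
have e20 : 0 < e / 2 by lra.
have /archi_boundP : 0 <= B * h%:R / (e / 2).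
  exact: divr_ge0 (mulr_ge0 (ltW B0) (ler0n _ _)) (ltW e20).
rewrite ltr_pdivrMr// => hm /(lt_le_trans hm); apply/negP; rewrite -leNgt.
apply: le_trans (ler_norm _) _; apply: le_trans (fB _) _.
rewrite ler_pM2l//; apply: norm_le => s; apply: le_trans (wN s) _.
by rewrite ler_nat.
Qed.

Lemma head_retr_le N s : (head 0%N (retr N s) <= head 0%N s)%N.
Proof.
case: (ltnP (head 0%N s) N) => [/head_retr ->//|/retr_far ->//].
Qed.

(** The whole tree has no finite height, so the height argument is applied
    twice. The retractions [r1 M], which contract to the root the branches starting
    with [M] or more, have height 1: they give [n0] such that [f] is small on
    functions living on the branches starting with [n >= n0]. The other branches
    have length at most [n0], and [r2 M] retracts only those. *)
Lemma dual_carried f e : 0 < e ->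
  exists N, forall w, (forall s, w (retr N s) = 0) -> `|f w| <= e * `|w|.
Proof.
move=> e0; have e20 : 0 < e / 2 by lra.
pose r1 M s := if (head 0%N s < M)%N then s else retr M s.
have r1C N M s : retr N (r1 M s) = r1 M (retr N s).
  rewrite /r1; case: ltnP => sM; case: ltnP => // sM'.
  - by move: (leq_trans sM' (head_retr_le N s)); rewrite leqNgt sM.
  - rewrite (retr_far sM); case: (ltnP (head 0%N s) N) => sN.
      by move: sM'; rewrite head_retr// ltnNge sM.
    by rewrite (retr_far sN).
  - exact: retr_retrC.
have [n0 wn0] : exists N, forall w, (forall s, w (r1 N s) = 0) ->
    `|f w| <= e / 2 * `|w|.
  apply: (@carried_of_height r1 (fun s => (s != [::])%N) 1) => //.
  - by move=> M s; rewrite /r1; case: ifP; [left|right].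
  - move=> N M s NM; rewrite /r1; case: (ltnP (head 0%N s) N) => sN.
      by rewrite (leq_trans sN NM) eqxx addn0.
    by rewrite (retr_far sN) eqxx/= add0n eq_sym.
  - by move=> M s; case: eqP.
pose r2 M s := if (head 0%N s < n0)%N then retr M s else s.
have r2C N M s : retr N (r2 M s) = r2 M (retr N s).
  rewrite /r2; case: ltnP => sn; case: ltnP => // sn'.
  - exact: retr_retrC.
  - by move: (leq_trans sn' (head_retr_le N s)); rewrite leqNgt sn.
  - case: (ltnP (head 0%N s) N) => sN.
      by move: sn'; rewrite head_retr// ltnNge sn.
    by rewrite (retr_far sN).
have [N1 wN1] : exists N, forall w, (forall s, w (r2 N s) = 0) ->
    `|f w| <= e / 2 * `|w|.
  apply: (@carried_of_height r2
    (fun s => if (head 0%N s < n0)%N then size s else 0%N) n0) => //.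
  - by move=> M s; rewrite /r2; case: ifP; [right|left].
  - move=> N M s NM; rewrite /r2; case: (ltnP (head 0%N s) n0) => sn; last first.
      by rewrite eqxx ltnNge sn.
    by rewrite !(leq_ltn_trans (head_retr_le _ s) sn); exact: retr_mono.
  - move=> M s; rewrite /r2; case: (ltnP (head 0%N s) n0) => sn; last by rewrite ltnNge sn.
    by case: ifP => // _; exact: leq_trans (size_retr M s) sn.
exists (maxn n0 N1) => w wN.
have w_nil : w [::] = 0 by rewrite -(wN [::]).
pose w1 := pullback w (fun K => r1C K n0).
have w1E s : w1 s = if (head 0%N s < n0)%N then w s else 0.
  by rewrite /= /r1; case: ltnP => // /retr_far ->.
have fw1 : `|f w1| <= e / 2 * `|w1|.
  apply: wN1 => s; rewrite w1E /r2; case: (ltnP (head 0%N s) n0) => sn.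
    case: ifP => // _.
    by rewrite -(wN (retr N1 s)) retr_retr (minn_idPr (leq_maxr n0 N1)).
  by rewrite ltnNge sn.
have fw2 : `|f (w - w1)| <= e / 2 * `|w - w1|.
  apply: wn0 => s; rewrite tree_valB w1E /r1.
  case: (ltnP (head 0%N s) n0) => sn; first by rewrite sn subrr.
  by rewrite (retr_far sn) w_nil if_same subrr.
have wE : w = w1 + (w - w1) by rewrite addrC subrK.
rewrite [X in f X]wE dualD (le_trans (ler_normD _ _))//.
rewrite [e in leRHS]splitr mulrDl lerD//.
  apply: le_trans fw1 _; rewrite ler_pM2l//; apply: norm_le => s.
  by rewrite w1E; case: ifP => _; rewrite ?normr0// norm_ge.
apply: le_trans fw2 _; rewrite ler_pM2l//; apply: norm_le => s.
by rewrite tree_valB w1E; case: ifP => _; rewrite ?subrr ?normr0 ?subr0// norm_ge.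
Qed.

End Shrinking.

(** * The weak-star topology *)

Section WeakStar.
Variables (R : realType) (X : normedModType R).

(** Weak-star convergence is pointwise convergence. *)
Lemma cvg_weak_star (F : set_system (dual X)) (FF : Filter F) (f : dual X) :
  (forall x, (fun g : dual X => (g x : R)) @ F --> (f x : R)) ->
  F --> (f : weak_star X).
Proof.
move=> Ff A /= [_ [[B oB <-] Bf sBA]].
have /(_ B) : {ptws, (@dual_val R X @ F) --> dual_val f}.
  by apply/pointwise_cvgP => x; exact: Ff.
rewrite nbhs_filterE; move=> /(_ (open_nbhs_nbhs (conj oB Bf))) FB.
exact: (filterS sBA FB).
Qed.

Lemma weak_star_eval_continuous (x : X) :
  continuous (fun f : weak_star X => ((f : dual X) x : R)).
Proof.
move=> f; have : {ptws, (@dual_val R X @ nbhs (f : weak_star X)) --> dual_val f}.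
  exact: (@initial_continuous _ _ (@dual_val R X : _ -> {ptws X -> R^o}) f).
by move/pointwise_cvgP => /(_ x).
Qed.

Lemma annihilator_closed I (x : I -> X) :
  closed ([set f | forall i, f (x i) = 0] : set (weak_star X)).
Proof.
pose A i : set (weak_star X) :=
  (fun f : weak_star X => ((f : dual X) (x i) : R)) @^-1` [set 0].
have cA : closed (\bigcap_(i in setT) A i).
  apply: closed_bigI => i _; apply: preimage_closed; last exact: closed_eq.
  by move=> f _; exact: weak_star_eval_continuous.
move: cA; congr (closed _); apply/seteqP.
by split=> f /= h i; [|move=> _]; exact: h.
Qed.

Lemma annihilator_submod I (x : I -> X) :
  submod_closed (mem [set f : dual X | forall i, f (x i) = 0]).
Proof.
split=> [|a f g /set_mem/= fx /set_mem/= gx]; apply/mem_set => i //.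
by rewrite dual_valD dual_valZ fx gx mulr0 addr0.
Qed.

End WeakStar.

(** * The dual norm is asymptotically midpoint uniformly convex *)

Section AMUC.
Variable R : realType.
Local Notation X := (tree_space R).
Implicit Types (x y z w : X) (s t : seq nat) (f g : dual X).

Lemma dirac_subproof s : (fun x : X => x s : R^o) \in @continuous_linear R X.
Proof.
apply: (@bounded_continuous_linear _ _ _ 1) => [a x y //|x].
by rewrite mul1r; exact: norm_ge.
Qed.

Definition dirac s : dual X := Dual (dirac_subproof s).

Lemma diracE s x : dirac s x = x s. Proof. by []. Qed.

Lemma tree_val_sum I (r : seq I) (F : I -> X) s :
  (\sum_(i <- r) F i) s = \sum_(i <- r) F i s.
Proof. by elim/big_rec2: _ => // i a b _ <-. Qed.

Definition atom N k : X := step_fun N (fun s => (s == k)%:R).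

Lemma atomE N k s : atom N k s = (retr N s == k)%:R. Proof. by []. Qed.

Lemma step_fun_sum N (u : seq nat -> R^o) :
  step_fun N u = \sum_(k <- retr_words N) u k *: atom N k.
Proof.
apply: treeP => s; rewrite tree_val_sum (bigD1_seq _ (mem_retr_words N s) (undup_uniq _)).
rewrite tree_valZ atomE eqxx mulr1 big1 => [|k]; first exact/esym/addr0.
by rewrite eq_sym tree_valZ atomE => /negPf ->; rewrite mulr0.
Qed.

(** The Dirac functionals at the points of [retr_words N] and the atoms form a
    biorthogonal system, apart from the words [k] with [retr N k != k], whose
    atom is zero. *)
Lemma step_annihilator_codim N :
  finite_codim [set f : dual X | forall u, f (step_fun N u) = 0].
Proof.
pose k (i : 'I_(size (retr_words N))) := nth [::] (retr_words N) i.
exists (size (retr_words N)), (fun i => dirac (k i)) => v.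
exists (fun i => v (atom N (k i))) => u.
rewrite dual_valB dual_val_sum [X in v X]step_fun_sum dual_sum.
rewrite (big_nth [::]) big_mkord; apply/eqP; rewrite subr_eq0; apply/eqP.
apply: eq_bigr => i _; rewrite -/(k i) dualZ dual_valZ diracE/= mulrC.
have [->//|ki] := eqVneq (retr N (k i)) (k i).
suff -> : atom N (k i) = 0 by rewrite dual0 !mul0r.
apply: treeP => s /=; case: eqP => // ks.
by move: ki; rewrite -ks retr_idem eqxx.
Qed.

Lemma step_annihilator_cof N :
  cof_weak_star [set f : dual X | forall u, f (step_fun N u) = 0].
Proof.
split; [exact: annihilator_submod|exact: annihilator_closed|].
exact: step_annihilator_codim.
Qed.

(** [t / 16] is the tolerance: [h] and its perturbations lose [3 * (t / 16)] on
    [f], and [t * (1 / 4)] is won on [g]. *)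
Lemma tree_space_AMUC : AMUC_star (dual_norm (fun x : X => `|x|)).
Proof.
move=> t t0; have e0 : 0 < t / 16 by lra.
apply: (@lt_le_trans _ _ (t / 16)%:E); first by rewrite lte_fin.
apply: le_ereal_inf_tmp => _ [f [_ f1] <-].
have [N fN] := dual_carried f e0.
set Y := [set f : dual X | forall u, f (step_fun N u) = 0].
apply: le_ereal_sup_tmp; eexists.
  by exists Y; [exact: step_annihilator_cof|reflexivity].
apply: le_ereal_inf_tmp => _ [g [Yg g1] <-]; rewrite lee_fin.
have X1 := @equivalent_norm_id R X.
set dn := dual_norm _ in f1 g1 *.
have big_at y : `|y| <= 1 -> 1 - 3 * (t / 16) <= f y -> 1 / 4 <= `|g y| ->
    t / 16 <= Num.max (dn (f + t *: g)) (dn (f - t *: g)) - 1.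
  move=> y1 fy gy; rewrite lerBrDr le_max; apply/orP.
  have tg : t * (1 / 4) <= t * `|g y| by rewrite ler_pM2l.
  have [gy0|gy0] := leP 0 (g y); [left|right].
    apply: le_trans (dual_norm_ball X1 _ y1); apply: le_trans _ (ler_norm _).
    by rewrite dual_valD dual_valZ; rewrite ger0_norm// in tg; lra.
  apply: le_trans (dual_norm_ball X1 _ y1); apply: le_trans _ (ler_norm _).
  by rewrite dual_valB dual_valZ; rewrite ltr0_norm// in tg; lra.
have [h h1 fh] : exists2 h, `|h| <= 1 & 1 - t / 16 < f h.
  by apply: (dual_norm_approx X1); rewrite -/dn f1; lra.
have [z z1 gz] : exists2 z, `|z| <= 1 & 1 / 2 < g z.
  by apply: (dual_norm_approx X1); rewrite -/dn g1; lra.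
pose z' := z - step_fun N z.
have z'0 s : z' (retr N s) = 0.
  by rewrite tree_valB/= retr_idem subrr.
have z'2 : `|z'| <= 2.
  apply: norm_le => s; rewrite tree_valB/= (le_trans (ler_normB _ _))//.
  by have := norm_ge z s; have := norm_ge z (retr N s); lra.
(* [g] takes values at distance [g z] at [y] and [y + z'], so it is at least
   [1 / 4] in absolute value at one of them. *)
have [y [y1 yz1 yh]] := midpoint_fun h1 z'2.
have near_h y' : `|y'| <= 1 -> (forall s, y' (retr N s) = h (retr N s)) ->
    1 - 3 * (t / 16) <= f y'.
  move=> y'1 y'h; have : `|f (h - y')| <= t / 16 * 2.
    have /fN/le_trans -> // : forall s, (h - y') (retr N s) = 0.
      by move=> s; rewrite tree_valB y'h subrr.
    by rewrite ler_pM2l// (le_trans (ler_normB _ _))//; lra.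
  by rewrite dualB ler_norml => /andP[? ?]; lra.
have gz' : g (y + z') - g y = g z by rewrite dualD dualB Yg subr0 addrC addKr.
have [gy|gy] := leP (1 / 4) `|g y|.
  by apply: big_at gy => //; apply: near_h => // s; exact: yh.
apply: (big_at (y + z')) => //.
  by apply: near_h => // s; rewrite tree_valD z'0 addr0; exact: yh.
have := ler_norm (g (y + z')); have := ler_norm (- g y); rewrite normrN; lra.
Qed.

End AMUC.

(** * Weak-star null sequences and finite codimension *)

(** An ultrafilter makes all the coordinates of a bounded sequence converge at
    once, which replaces the extraction of subsequences. *)
Lemma ultra_bounded_cvg (R : realType) (T : Type) (U : set_system T)
    (a : R) (u : T -> R) :
  UltraFilter U -> (forall k, `|u k| <= a) -> exists l : R, u @ U --> l.
Proof.
move=> UU ua.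
have [|l [_ lU]] := @segment_compact R (- a) a (u @ U) _.
  rewrite /= nbhs_filterE/=; apply: filterE => k /=.
  by rewrite in_itv/= -ler_norml.
exists l => B lB; rewrite nbhs_filterE/=.
have [//|nB] := in_ultra_setVsetC (u @^-1` B) UU.
by have [r [? ?]] := lU (~` B) B nB lB.
Qed.

Section WeakStarNull.
Variables (R : realType) (X : normedModType R) (p : X -> R).
Hypothesis p_equiv : equivalent_norm p.
Local Notation N := (dual_norm p).

(** Write [u k] modulo [Y] as a combination [comb (c k)] of finitely many
    vectors, with coefficients of nearly minimal [l1]-norm [M k]. If [u k] stays
    away from [Y] then [M k] is bounded below, and the normalised coefficients
    [c k / M k] have a limit [l]. Since [u k / M k] is weak-star null and [Y] is
    closed, [comb l] is in [Y]. Subtracting [M k * l] from [c k] then gives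
    coefficients for [u k] of norm much smaller than [M k], a
    contradiction. *)
Lemma weak_star_null_near_cof (Y : set (dual X)) (u : nat -> dual X) (e : R) :
  cof_weak_star Y -> (forall x, (u k x : R) @[k --> \oo] --> (0 : R)) ->
  0 < e -> exists k, exists2 y, Y y & N (u k - y) <= e.
Proof.
move=> [Ysub Ycl [n [b Yb]]] u0 e0; apply: contrapT => far.
have {}far k y : Y y -> e < N (u k - y).
  by move=> Yy; rewrite ltNge; apply/negP => h; apply: far; exists k, y.
have YL a f g : Y f -> Y g -> Y (a *: f + g).
  by move=> Yf Yg; apply/set_mem; apply: Ysub.2; exact/mem_set.
pose comb (c : 'I_n -> R) : dual X := \sum_(i < n) c i *: b i.
pose l1 (c : 'I_n -> R) : R := \sum_(i < n) `|c i|.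
pose B := 1 + \sum_(i < n) N (b i).
have Nb0 i : 0 <= N (b i) by exact: dual_norm_ge0.
have B0 : 0 < B by rewrite ltr_pwDl// sumr_ge0.
have comb_le c : N (comb c) <= B * l1 c.
  rewrite mulr_sumr; apply: le_trans (dual_norm_sum p_equiv _ _) _.
  apply: ler_sum => i _; rewrite dual_normZ// mulrC ler_wpM2r//.
  by rewrite /B (bigD1 i)//= addrCA lerDl addr_ge0// sumr_ge0.
have l1_far k c : Y (u k - comb c) -> e / B < l1 c.
  move=> /(far k); rewrite subKr ltr_pdivrMr// mulrC => h.
  exact: lt_le_trans h (comb_le c).
have eB0 : 0 < e / B by rewrite divr_gt0.
have /choice[c cP] k : exists c, Y (u k - comb c) /\
    forall c', Y (u k - comb c') -> l1 c <= 2 * l1 c'.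
  pose S := [set l1 c | c in [set c | Y (u k - comb c)]].
  have S0 : S !=set0 by have [c cY] := Yb (u k); exists (l1 c), c.
  have Slb : lbound S (e / B) by move=> _ [c cY <-]; exact/ltW/(l1_far k).
  have Sinf : has_inf S by split=> //; exists (e / B).
  have inf0 : 0 < inf S by apply: lt_le_trans eB0 _; exact: lb_le_inf.
  have [_ [c cY <-] cinf] := inf_adherent inf0 Sinf.
  exists c; split=> // c' c'Y.
  have : inf S <= l1 c' by apply: ge_inf; [exists (e / B)|exists c'].
  lra.
pose M k := l1 (c k).
have MeB k : e / B < M k by apply: l1_far; exact: (cP k).1.
have M0 k : 0 < M k by apply: lt_trans eB0 _.
have cM k i : `|c k i| <= M k.
  by rewrite /M /l1 (bigD1 i)//= lerDl sumr_ge0.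
have [U [UU ooU]] := ultraFilterLemma (_ : ProperFilter (\oo : set_system nat)).
have /choice[l lP] i : exists l, (c k i / M k) @[k --> U] --> (l : R).
  apply: (@ultra_bounded_cvg _ _ _ 1) => k.
  by rewrite normrM normfV (gtr0_norm (M0 k)) ler_pdivrMr// mul1r.
have combE a x : comb a x = \sum_(i < n) a i * b i x by rewrite /comb dual_val_sum.
pose w k := comb (fun i => c k i / M k) - (M k)^-1 *: u k.
have wE x k : w k x = \sum_(i < n) c k i / M k * b i x - (M k)^-1 * u k x.
  by rewrite dual_valB combE.
have Yw k : Y (w k).
  have -> : w k = - (M k)^-1 *: (u k - comb (c k)) + 0.
    rewrite addr0 scaleNr scalerBr opprB; congr (_ - _).
    rewrite scaler_sumr; apply: eq_bigr => i _.
    by rewrite scalerA mulrC.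
  by apply: YL; [exact: (cP k).1|apply/set_mem; exact: Ysub.1].
have UF : Filter U by exact: (@ultra_proper _ U UU).
have null x : ((M k)^-1 * u k x : R) @[k --> U] --> (0 : R).
  apply/cvgr0Pnorm_le => d d0; apply: ooU.
  have deB : 0 < d * (e / B) by rewrite mulr_gt0.
  have /cvgr0_norm_le/(_ _ deB) := u0 x; apply: filterS => k uk.
  rewrite normrM gtr0_norm ?invr_gt0// ler_pdivrMl//; apply: le_trans uk _.
  by rewrite mulrC ler_pM2r// ltW.
have w_lim x : (w k x : R) @[k --> U] --> (comb l x : R).
  under eq_cvg do rewrite wE.
  rewrite -[comb l x]subr0 combE; apply: cvgB; last exact: null.
  apply: (cvg_big (op := +%R)) => [|i _]; first exact: add_continuous.
  by apply: cvgMr_tmp; exact: lP.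
have Yl : Y (comb l).
  apply: (@closed_cvg _ _ U _ (w : nat -> weak_star X) _ Ycl (nearW _ Yw)).
  exact: cvg_weak_star.
have dist_lim : (\sum_(i < n) `|c k i / M k - l i|) @[k --> U] -->
    (\sum_(i < n) `|l i - l i| : R).
  apply: (cvg_big (op := +%R)) => [|i _]; first exact: add_continuous.
  by apply: cvg_norm; apply: cvgB; [exact: lP|exact: cvg_cst].
rewrite [X in _ --> X]big1 in dist_lim; last first.
  by move=> i _; rewrite subrr normr0.
have half0 : 0 < 1 / 2 :> R by lra.
have /cvgr0_norm_lt/(_ _ half0)/filter_ex[k] := dist_lim.
rewrite ger0_norm ?sumr_ge0// => close.
pose c' i := c k i - M k * l i.
have c'Y : Y (u k - comb c').
  have -> : u k - comb c' = M k *: comb l + (u k - comb (c k)).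
    rewrite [RHS]addrCA; congr (_ + _).
    rewrite scaler_sumr -sumrN -sumrN -big_split/=; apply: eq_bigr => i _.
    by rewrite scalerBl opprB scalerA.
  by apply: YL => //; exact: (cP k).1.
have := (cP k).2 _ c'Y; rewrite -/(M k).
have -> : l1 c' = M k * \sum_(i < n) `|c k i / M k - l i|.
  rewrite mulr_sumr; apply: eq_bigr => i _.
  rewrite -[X in X * _](gtr0_norm (M0 k)) -normrM mulrBr mulrCA mulfV ?gt_eqF//.
  by rewrite mulr1.
rewrite mulrCA -[leLHS]mulr1 ler_pM2l//; lra.
Qed.

End WeakStarNull.

(** * No equivalent norm has an asymptotically uniformly convex dual *)

Section NotAUC.
Variable R : realType.
Local Notation X := (tree_space R).
Implicit Types (x : X) (s : seq nat).

Lemma bounded_entries s : exists M0, forall M, (M0 <= M)%N -> all (ltn^~ M) s.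
Proof.
elim: s => [|k s [M0 IH]]; first by exists 0%N.
exists (maxn k.+1 M0) => M; rewrite geq_max => /andP[kM M0M] /=.
by rewrite [(k < M)%N]kM IH.
Qed.

Lemma child_cvg s x : node s -> (x (rcons s k) : R) @[k --> \oo] --> (x s : R).
Proof.
move=> nd; apply/cvgrPdist_le => e e0.
have [N xN] := tree_continuous_near (tree_valP x) e0.
have [M0 sM] := bounded_entries s; pose M := maxn N M0.
exists M => // k /= Mk.
rewrite -[X in `|x X - _|](retr_child (sM M (leq_maxr _ _)) nd Mk).
by apply: xN; exact: leq_maxl.
Qed.

Lemma norm_atom N k : `|atom R N k| <= 1.
Proof.
by apply: norm_le => s; rewrite atomE; case: eqP; rewrite ?normr1 ?normr0.
Qed.

(** The nodes that are not leaves. *)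
Definition inner s := (0 < size s <= head 0%N s)%N.

Lemma inner_node s : inner s -> node s.
Proof. by move=> /andP[s0 sh]; rewrite /node s0 ltnW. Qed.

Lemma node_child s k : inner s -> node (rcons s k).
Proof. by case: s => // n s; rewrite /inner /node /= size_rcons !ltnS. Qed.

Variable p : X -> R.
Hypothesis p_equiv : equivalent_norm p.
Local Notation N := (dual_norm p).

Variables c C : R.
Hypotheses (c0 : 0 < c) (C0 : 0 < C)
  (pcC : forall x, c * `|x| <= p x <= C * `|x|).

(** [C^-1] bounds below the norm of every functional taking the value 1 in the
    original unit ball. *)
Lemma dual_norm_test (f : dual X) x : `|x| <= 1 -> f x = 1 -> C^-1 <= N f.
Proof.
move=> x1 fx; rewrite -[leLHS]mul1r ler_pdivrMr//.
have := dual_norm_ge p_equiv f x; rewrite fx normr1 => /le_trans; apply.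
apply: ler_wpM2l; first exact: dual_norm_ge0.
have /andP[_ h] := pcC x; apply: le_trans h _.
by rewrite -[leRHS]mulr1 ler_pM2l.
Qed.

Lemma dirac_ge s : C^-1 <= N (dirac R s).
Proof.
apply: (dual_norm_test (x := cst_fun 1)); last by rewrite diracE.
by apply: norm_le => t; rewrite cst_funE normr1.
Qed.

Lemma dirac_le s : N (dirac R s) <= c^-1.
Proof.
apply: dual_norm_le => // x px; apply: le_trans (norm_ge x s) _.
rewrite -(ler_pM2l c0) mulfV ?gt_eqF//.
by apply: le_trans px; case/andP: (pcC x).
Qed.

(** The atom at the child takes the values 1 and 0 at the child and at [s]. *)
Lemma child_far s k : inner s -> C^-1 <= N (dirac R (rcons s k) - dirac R s).
Proof.
move=> ins; have [M1 sM1] := bounded_entries s.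
have [M2 sM2] := bounded_entries (rcons s k); pose M := maxn M1 M2.
apply: (dual_norm_test (norm_atom M (rcons s k))).
rewrite dual_valB !diracE !atomE.
rewrite (retr_node (sM1 M (leq_maxl _ _)) (inner_node ins)).
rewrite (retr_node (sM2 M (leq_maxr _ _)) (node_child k ins)).
rewrite eqxx (negPf (_ : s != rcons s k)) ?subr0//.
by apply/eqP => /(congr1 size)/eqP; rewrite size_rcons -[X in X == _]addn0 -addn1 eqn_add2l.
Qed.

(** Let [r] be the norm of the Dirac functional at [s] and [f] its
    normalisation. Choose [Y] for [f], a child whose Dirac functional differs
    from that at [s] by nearly an element [y] of [Y], and [g] the normalisation
    of [y]. The point [f + t *: g] lies between [f] and
    [r^-1 *: (dirac R s + y)], as [t] is a lower bound for the ratio of [N y]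
    to [r]; by convexity the latter has norm at least [1 + d]. *)
Lemma dirac_growth : AUC_star N ->
  exists2 h, 0 < h & forall s, inner s ->
    exists k, (1 + h) * N (dirac R s) <= N (dirac R (rcons s k)).
Proof.
move=> auc; pose t := C^-1 / 2 * c.
have Ci0 : 0 < C^-1 by rewrite invr_gt0.
have t0 : 0 < t by rewrite mulr_gt0// divr_gt0.
have [d d0 dP] : exists2 d : R, 0 < d & forall f, N f = 1 ->
    exists2 Y, cof_weak_star Y & forall g, Y g -> N g = 1 -> d <= N (f + t *: g) - 1.
  move: (auc t t0); set I := ereal_inf _ => I0.
  have [d d0 dI] : exists2 d : R, 0 < d & (d%:E < I)%E.
    case: I I0 => [r||]; rewrite ?lte_fin// => r0.
      by exists (r / 2); rewrite ?lte_fin; lra.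
    by exists 1; rewrite ?ltry.
  exists d => // f f1.
  have sf : unit_sphere N setT f by split.
  have fI := ereal_inf_lbound (imageP _ sf) : (I <= _)%E.
  have [_ [Y cofY <-] dY] := ereal_sup_gt (lt_le_trans dI fI).
  exists Y => // g Yg g1; rewrite -lee_fin; apply: le_trans (ltW dY) _.
  by apply: ereal_inf_lbound; exists g.
exists (d / 2) => [|s ins]; first by lra.
set r := N (dirac R s).
have r_ge : C^-1 <= r by exact: dirac_ge.
have r0 : 0 < r by apply: lt_le_trans r_ge.
pose f := r^-1 *: dirac R s.
have f1 : N f = 1.
  by rewrite dual_normZ// gtr0_norm ?invr_gt0// mulVf// gt_eqF.
have [Y cofY fY] := dP f f1.
pose u k := dirac R (rcons s k) - dirac R s.
(* The first bound keeps [y] away from 0, the second costs at most half of the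
   gain [r * d]. *)
pose e := Num.min (C^-1 / 2) (C^-1 * d / 2).
have e0 : 0 < e by rewrite lt_min !divr_gt0//= mulr_gt0.
have u0 x : (u k x : R) @[k --> \oo] --> (0 : R).
  rewrite -(subrr (x s)); apply: cvgB; last exact: cvg_cst.
  exact/child_cvg/inner_node.
have [k [y Yy uy]] := weak_star_null_near_cof p_equiv cofY u0 e0.
exists k.
have e1 : e <= C^-1 / 2 by rewrite ge_min lexx.
have e2 : e <= C^-1 * d / 2 by rewrite ge_min lexx orbT.
have Ny : C^-1 / 2 <= N y.
  have : N (u k) <= N (u k - y) + N y.
    by rewrite -[X in N X <= _](subrK y); exact: dual_normD.
  by have := child_far k ins; rewrite -/(u k); lra.
have Ny0 : 0 < N y by lra.
have := fY ((N y)^-1 *: y).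
have [Ysub _ _] := cofY.
have Yg : Y ((N y)^-1 *: y).
  rewrite -[_ *: y]addr0; apply/set_mem/Ysub.2; first exact/mem_set.
  exact: Ysub.1.
have g1 : N ((N y)^-1 *: y) = 1.
  by rewrite dual_normZ// gtr0_norm ?invr_gt0// mulVf// gt_eqF.
move=> /(_ Yg g1).
pose a := t * r / N y.
have a0 : 0 < a by rewrite !divr_gt0// mulr_gt0.
have a1 : a <= 1.
  rewrite ler_pdivrMr// mul1r; apply: le_trans Ny.
  rewrite -mulrA; apply: ler_piMr; first by lra.
  by rewrite -(mulfV (lt0r_neq0 c0)) ler_pM2l// dirac_le.
have -> : f + t *: ((N y)^-1 *: y) =
    (1 - a) *: f + a *: (r^-1 *: (dirac R s + y)).
  rewrite scalerBl scale1r !scalerDr addrA subrK scalerA scalerA.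
  by congr (_ + _ *: _); rewrite /a [RHS]mulrAC mulfK// gt_eqF.
have := dual_normD p_equiv ((1 - a) *: f) (a *: (r^-1 *: (dirac R s + y))).
rewrite (dual_normZ p_equiv (1 - a) f) f1 mulr1 ger0_norm ?subr_ge0//.
rewrite !(dual_normZ p_equiv) (gtr0_norm a0) gtr0_norm ?invr_gt0//.
have : N (dirac R s + y) <= N (dirac R (rcons s k)) + e.
  have -> : dirac R s + y = dirac R (rcons s k) - (u k - y).
    by rewrite opprB addrCA subKr addrC.
  by apply: le_trans (dual_normB p_equiv _ _) _; rewrite lerD2l.
set D := N (dirac R s + y); set K := N (dirac R (rcons s k)) => DK h1 h2.
have h3 : d <= a * (r^-1 * D - 1) by lra.
have h4 : d <= r^-1 * D - 1.
  rewrite leNgt; apply/negP => h.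
  have [b0|b0] := leP (r^-1 * D - 1) 0.
    have : a * (r^-1 * D - 1) <= 0 by rewrite pmulr_rle0.
    by lra.
  have : a * (r^-1 * D - 1) <= r^-1 * D - 1 by rewrite ler_piMl// ltW.
  by lra.
have h5 : r * (1 + d) <= D.
  by rewrite -(ler_pM2l (_ : 0 < r^-1)) ?invr_gt0// mulKf ?gt_eqF//; lra.
have h6 : C^-1 * d <= r * d by rewrite ler_pM2r.
lra.
Qed.

Lemma not_AUC : ~ AUC_star N.
Proof.
move=> /dirac_growth[h h0 grow].
(* The linear bound of Bernoulli for [(1 + h) ^+ j]. *)
have chain n j : (j <= n)%N -> exists s,
    [/\ head 0%N s = n, size s = j.+1 & C^-1 * (1 + j%:R * h) <= N (dirac R s)].
  elim: j => [_|j IH jn].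
    by exists [:: n]; split=> //; rewrite mul0r addr0 mulr1 dirac_ge.
  have [s [sn sj Ns]] := IH (ltnW jn).
  have ins : inner s by rewrite /inner sn sj.
  have [k gk] := grow s ins; exists (rcons s k); split.
  - by case: s sn sj {Ns ins gk}.
  - by rewrite size_rcons sj.
  apply: le_trans gk; apply: (@le_trans _ _ ((1 + h) * (C^-1 * (1 + j%:R * h)))).
    rewrite mulrCA ler_pM2l ?invr_gt0// mulrDl mul1r -natr1 mulrDl mul1r addrA.
    by rewrite lerD2l mulrDr mulr1 lerDl !mulr_ge0// ltW.
  by rewrite ler_pM2l// addr_gt0.
have [s [_ _ Ns]] := chain _ _ (leqnn (Num.bound (C / (c * h)))).
have ch0 : 0 < c * h by rewrite mulr_gt0.
have /archi_boundP : 0 <= C / (c * h) by rewrite divr_ge0// ltW.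
set n := _%:R in Ns *; apply/negP; rewrite -leNgt.
have := le_trans Ns (dirac_le s).
rewrite mulrC ler_pdivrMr// => nh.
rewrite ler_pdivlMr// mulrCA.
have : c * (1 + n * h) <= C by rewrite -ler_pdivlMl.
by rewrite mulrDr mulr1; apply: le_trans; rewrite lerDr ltW.
Qed.

End NotAUC.

Theorem mainTheorem8 (R : realType) :
  exists X : completeNormedModType R,
    [/\ separable X,
        AMUC_star (dual_norm (fun x : X => `|x|))
      & ~ exists p : X -> R, equivalent_norm p /\ AUC_star (dual_norm p)].
Proof.
exists (tree_space R); split.
- exact: tree_separable.
- exact: tree_space_AMUC.
- move=> [p [p_equiv]]; case: (p_equiv) => _ [c [C [c0 C0 pcC]]].
  exact: not_AUC pcC.
Qed.
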